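(* There are no minimal monads on $\mathbb{P}^3$ of the form $$\mathcal{O}_{\mathbb{P}^3}(-2)\oplus\mathcal{O}_{\mathbb{P}^3}(-4)\to3\cdot\mathcal{O}_{\mathbb{P}^3}(1)\oplus3\cdot\mathcal{O}_{\mathbb{P}^3}(-2)\to\mathcal{O}_{\mathbb{P}^3}(1)\oplus\mathcal{O}_{\mathbb{P}^3}(3).$$
   Context: $\mathbb{P}^3$ is projective 3-space over an algebraically closed field of characteristic zero; $m\cdot\mathcal{L}$ denotes $\mathcal{L}^{\oplus m}$. A monad is a complex of vector bundles $\mathcal{C}\xrightarrow{\beta}\mathcal{B}\xrightarrow{\alpha}\mathcal{A}$ with $\beta$ injective (and locally left invertible) and $\alpha$ surjective. It is minimal if no direct summand of $\mathcal{A}$ is the image of a line subbundle of $\mathcal{B}$ and no direct summand of $\mathcal{C}$ goes onto a direct summand of $\mathcal{B}$. *)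

(* Defs.v *)
From HB Require Import structures.
From mathcomp Require Import all_boot all_order all_algebra.
From mathcomp Require Import mpoly.

Set Implicit Arguments.
Unset Strict Implicit.
Unset Printing Implicit Defensive.

Import GRing.Theory.
Local Open Scope ring_scope.

(* P^n over the algebraically closed field k is handled classically, through  *)
(* its closed points: a point is given by homogeneous coordinates, a nonzero  *)
(* x : 'rV[k]_n.+1, and subsets of P^n are identified with the subsets of     *)
(* k^(n+1) \ {0} lying above them.                                            *)

(* Stability under rescaling is automatic: U is a union of sets D(h) with h   *)
(* homogeneous.                                                               *)
Definition zariski_open (k : closedFieldType) (n : nat)
    (U : 'rV[k]_n.+1 -> Prop) : Prop :=
  (forall x, U x -> x != 0) /\
  (forall x, U x -> exists (e : nat) (h : {mpoly k[n.+1]}),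
     [/\ h \is e.-homog, h.@[x 0] != 0
       & forall y : 'rV[k]_n.+1, y != 0 -> h.@[y 0] != 0 -> U y]).

(* Sections of the sheaf O(d) over the open set U: functions of the           *)
(* homogeneous coordinates that are locally a quotient p / q of forms with    *)
(* deg p - deg q = d.  In particular s (l x) = l^d (s x) for l != 0.          *)
Definition twist_section (k : closedFieldType) (n : nat)
    (U : 'rV[k]_n.+1 -> Prop) (d : int) (s : 'rV[k]_n.+1 -> k) : Prop :=
  forall x, U x -> exists (e f : nat) (p q : {mpoly k[n.+1]}),
    [/\ p \is e.-homog, q \is f.-homog, e%:Z = f%:Z + d, q.@[x 0] != 0
      & forall y, U y -> q.@[y 0] != 0 -> s y = p.@[y 0] / q.@[y 0]].

(* A tuple b : m.-tuple int stands for the vector bundle                      *)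
(* O(b_0) (+) ... (+) O(b_(m-1)).  Its fibre is the space of row vectors      *)
(* 'rV[k]_m, where (x, v) and (l x, (l^(b_i) v_i)_i) denote the same vector.  *)
(* Linear maps act by right multiplication, so that the composite of f        *)
(* followed by g is f x *m g x.  The component O(b_i) -> O(a_j) of a morphism *)
(* over U is a section of O(a_j - b_i) over U.                                *)
Definition bundle_hom (k : closedFieldType) (n m p : nat)
    (U : 'rV[k]_n.+1 -> Prop) (b : m.-tuple int) (a : p.-tuple int)
    (f : 'rV[k]_n.+1 -> 'M[k]_(m, p)) : Prop :=
  forall i j, twist_section U (tnth a j - tnth b i) (fun x => f x i j).

Definition projective_space (k : closedFieldType) (n : nat) :
  'rV[k]_n.+1 -> Prop := fun x => x != 0.

(* A subbundle of rank r, as the family x |-> W x of its fibres (row spaces), *)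
(* locally spanned by a frame, i.e. a fibrewise injective map from O^r.       *)
Definition subbundle (k : closedFieldType) (n m : nat) (b : m.-tuple int)
    (r : nat) (W : 'rV[k]_n.+1 -> 'M[k]_m) : Prop :=
  forall x, x != 0 ->
  exists (U : 'rV[k]_n.+1 -> Prop) (F : 'rV[k]_n.+1 -> 'M[k]_(r, m)),
    [/\ zariski_open U, U x, bundle_hom U (nseq_tuple r 0) b F
      & forall y, U y -> row_free (F y) /\ (F y == W y)%MS].

Definition direct_summand (k : closedFieldType) (n m : nat) (b : m.-tuple int)
    (r : nat) (W : 'rV[k]_n.+1 -> 'M[k]_m) : Prop :=
  subbundle b r W /\
  exists (r' : nat) (W' : 'rV[k]_n.+1 -> 'M[k]_m),
    subbundle b r' W' /\
    (forall x, x != 0 ->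
       (W x + W' x == 1%:M)%MS /\ (W x :&: W' x)%MS = 0).

Definition locally_left_invertible (k : closedFieldType) (n m p : nat)
    (b : m.-tuple int) (a : p.-tuple int)
    (f : 'rV[k]_n.+1 -> 'M[k]_(m, p)) : Prop :=
  forall x, x != 0 ->
  exists (U : 'rV[k]_n.+1 -> Prop) (g : 'rV[k]_n.+1 -> 'M[k]_(p, m)),
    [/\ zariski_open U, U x, bundle_hom U a b g
      & forall y, U y -> f y *m g y = 1%:M].

Definition is_monad (k : closedFieldType) (n l m p : nat)
    (c : l.-tuple int) (b : m.-tuple int) (a : p.-tuple int)
    (beta : 'rV[k]_n.+1 -> 'M[k]_(l, m))
    (alpha : 'rV[k]_n.+1 -> 'M[k]_(m, p)) : Prop :=
  [/\ bundle_hom (@projective_space k n) c b beta,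
      bundle_hom (@projective_space k n) b a alpha,
      forall x, x != 0 -> beta x *m alpha x = 0,
      (forall x, x != 0 -> row_free (beta x)) /\
        locally_left_invertible c b beta
    & forall x, x != 0 -> row_full (alpha x)].

(* The summand D reached in each clause is required to be nonzero: otherwise  *)
(* the zero summand of C would violate the second clause for every monad.     *)
Definition is_minimal (k : closedFieldType) (n l m p : nat)
    (c : l.-tuple int) (b : m.-tuple int) (a : p.-tuple int)
    (beta : 'rV[k]_n.+1 -> 'M[k]_(l, m))
    (alpha : 'rV[k]_n.+1 -> 'M[k]_(m, p)) : Prop :=
  ~ (exists (r : nat) (D : 'rV[k]_n.+1 -> 'M[k]_p)
            (L : 'rV[k]_n.+1 -> 'M[k]_m),
       [/\ (0 < r)%N, direct_summand a r D, subbundle b 1 L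
         & forall x, x != 0 -> (L x *m alpha x == D x)%MS]) /\
  ~ (exists (s r : nat) (S : 'rV[k]_n.+1 -> 'M[k]_l)
            (D : 'rV[k]_n.+1 -> 'M[k]_m),
       [/\ (0 < r)%N, direct_summand c s S, direct_summand b r D
         & forall x, x != 0 -> (S x *m beta x == D x)%MS]).

(* Main.v *)
Require Import Defs.
From HB Require Import structures.
From mathcomp Require Import all_boot all_order all_algebra.
From mathcomp Require Import mpoly.
From Stdlib Require Import Classical.

Set Implicit Arguments.
Unset Strict Implicit.
Unset Printing Implicit Defensive.

Import GRing.Theory.
Local Open Scope ring_scope.

(** The first column of alpha is the component of alpha on the summand O(1) of
    the target.  Its three entries on 3.O(1) are sections of O, its three
    entries on 3.O(-2) are sections of O(3), that is, three cubic forms in four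
    variables.  Three forms in four variables always have a common zero x in
    P^3, so surjectivity of alpha at x forces one of the three constants to be
    nonzero.  That is what minimality forbids: a nonzero constant entry makes
    the corresponding line subbundle O(1) of the middle term map isomorphically
    onto a direct summand of the target.

    The argument is short because the geometry behind it is classical, and this
    geometry is what most of the file develops.

    - [forms_common_zero]: r forms of positive degree in n > r variables have a
      common nontrivial zero.  By the homogeneous Nullstellensatz
      ([projective_nullstellensatz], proved by eliminating one variable at a
      time) the ideal of r forms without common zero contains a power X_i^N of
      every variable.  Every polynomial is then a combination of products of a
      monomial with exponents below N by a monomial in the r forms.  In degree
      at most D there are O(D^r) such products, too few to span the
      polynomials, whose dimension grows like D^n.

    - [global_section_form] and [global_section0_constant]: a global section of
      O(d), given only by local quotients of forms, is a form of degree d.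
      Unique factorization is used only in one variable: on each line a
      function that is everywhere a local quotient is a polynomial, with degree
      at most d by homogeneity.  A function that is a polynomial of bounded
      degree in each variable separately is a polynomial, by Lagrange
      interpolation.

    - [minimal_entry_vanishes]: an entry of alpha that vanishes nowhere
      contradicts minimality. *)

(** * Ideals of polynomials in one variable *)

Definition is_ideal (R : nzRingType) (I : R -> Prop) : Prop :=
  [/\ I 0, forall p q, I p -> I q -> I (p + q)
    & forall a p, I p -> I (a * p)].

Lemma ideal_sum (R : nzRingType) (I : R -> Prop) (T : Type) (s : seq T)
    (P : pred T) (F : T -> R) :
  is_ideal I -> (forall i, P i -> I (F i)) -> I (\sum_(i <- s | P i) F i).
Proof. by case=> I0 ID _ IF; apply: (big_ind I). Qed.

Lemma ideal_rmodp (R : comNzRingType) (J : {poly R} -> Prop) (f g : {poly R}) :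
  is_ideal J -> g \is monic -> J f -> J g -> J (Pdiv.Ring.rmodp f g).
Proof.
move=> [_ JD JM] mg Jf Jg.
have -> : Pdiv.Ring.rmodp f g = f + - Pdiv.Ring.rdivp f g * g.
  by rewrite {2}(Pdiv.RingMonic.rdivp_eq mg f) mulNr addrC addKr.
by apply: JD => //; apply: JM.
Qed.

Lemma size_map_monic (R S : nzRingType) (phi : {rmorphism R -> S})
    (g : {poly R}) : g \is monic -> size (map_poly phi g) = size g.
Proof.
by move=> /monicP mg; rewrite size_map_poly_id0 // mg rmorph1 oner_neq0.
Qed.

Lemma map_rmodp_monic (R S : comNzRingType) (phi : {rmorphism R -> S})
    (f g : {poly R}) : g \is monic ->
  map_poly phi (Pdiv.Ring.rmodp f g) =
    Pdiv.Ring.rmodp (map_poly phi f) (map_poly phi g).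
Proof.
move=> mg; rewrite {2}(Pdiv.RingMonic.rdivp_eq mg f) rmorphD rmorphM /=.
rewrite Pdiv.RingMonic.rmodp_addl_mul_small ?monic_map //.
rewrite (size_map_monic _ mg); apply: leq_ltn_trans (size_poly _ _) _.
by rewrite Pdiv.Ring.ltn_rmodpN0 ?monic_neq0.
Qed.

(** Elimination of the variable of [{poly R}]: multiplication by f on
    R[X]/(g), a free R-module because g is monic, has a matrix M over R, and
    Cramer's rule expresses the constant det M as a combination of f and g.  As
    phi maps f to 1, it maps M to the identity and det M to 1. *)
Lemma elimination_ideal (R S : comNzRingType) (phi : {rmorphism R -> S})
    (J : {poly R} -> Prop) (f g : {poly R}) :
  is_ideal J -> g \is monic -> J g -> J f -> map_poly phi f = 1 ->
  exists2 h : R, J h%:P & phi h = 1.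
Proof.
move=> idJ mg Jg Jf phif; have [J0 JD JM] := idJ.
have := size_poly_eq0 g; rewrite (negPf (monic_neq0 mg)).
case def_d: (size g) => [|[|d]] // _.
  (* g = 1, so J is the unit ideal; below, M has positive size. *)
  exists 1; last by rewrite rmorph1.
  have /size_poly1P[c _ def_g] : size g == 1%N by rewrite def_d.
  by move: mg Jg; rewrite def_g monicE lead_coefC => /eqP->.
pose M : 'M[R]_d.+1 := \matrix_(i, j) (Pdiv.Ring.rmodp (f * 'X^i) g)`_j.
have size_rem p : (size (Pdiv.Ring.rmodp p g) <= d.+1)%N.
  by rewrite -ltnS -def_d Pdiv.Ring.ltn_rmodpN0 ?monic_neq0.
exists (\det M).
  have -> : (\det M)%:P
          = \sum_i (\adj M 0 i)%:P * Pdiv.Ring.rmodp (f * 'X^i) g.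
    transitivity (\sum_j ((\adj M *m M) 0 j)%:P * 'X^j).
      rewrite mul_adj_mx (bigD1 0) //= mxE eqxx mulr1 big1 ?addr0 // => j j0.
      by rewrite mxE eq_sym (negPf j0) polyC0 mul0r.
    under eq_bigr => j _.
      rewrite mxE rmorph_sum /= mulr_suml.
      under eq_bigr do rewrite polyCM -mulrA.
    over.
    rewrite exchange_big /=; apply: eq_bigr => i _; rewrite -mulr_sumr.
    congr (_ * _); rewrite -[RHS](take_poly_id (size_rem _)).
    rewrite /take_poly poly_def.
    by apply: eq_bigr => j _; rewrite mxE mul_polyC.
  apply: ideal_sum => // i _; apply: (JM); apply: ideal_rmodp => //.
  by rewrite mulrC; apply: JM.
rewrite -det_map_mx -[RHS](det1 S d.+1); congr (\det _).
apply/matrixP=> i j; rewrite !mxE -coef_map map_rmodp_monic // rmorphM /= phif.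
rewrite mul1r map_polyXn Pdiv.Ring.rmodp_small ?coefXn 1?eq_sym //.
by rewrite size_map_monic // size_polyXn def_d ltnS.
Qed.

(** A nonzero element of least size divides every element of J, and has a root
    because it is not a constant.  The proof descends to it by replacing P with
    a nonzero remainder modulo P. *)
Lemma ideal_common_root (k : closedFieldType) (J : {poly k} -> Prop) :
  is_ideal J -> ~ J 1 -> exists b, forall P, J P -> root P b.
Proof.
move=> [J0 JD JM] J1.
case: (classic (exists2 P, J P & P != 0)) => [[P0 JP0 nzP0]|noP]; last first.
  exists 0 => P JP; have [->|nzP] := eqVneq P 0; first exact: root0.
  by case: noP; exists P.
have [m] := ubnP (size P0); elim: m P0 JP0 nzP0 => // m IHm P JP nzP leP.
case: (classic (exists2 Q, J Q & ~~ (P %| Q))) => [[Q JQ ndvd]|dvdP].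
  apply: (IHm (Q %% P)); last first.
  - by rewrite -ltnS (leq_trans _ leP) // !ltnS ltn_modp.
  - by apply: contra ndvd => /eqP modP; apply/modp_eq0P.
  have -> : Q %% P = Q + - (Q %/ P) * P.
    by rewrite {2}(divp_eq Q P) mulNr addrC addKr.
  by apply: JD => //; apply: JM.
have /closed_rootP[b rootb] : size P != 1.
  apply: contra_notN J1 => /size_poly1P[c nzc defP].
  have -> : 1 = c^-1%:P * P by rewrite defP -polyCM mulVf.
  exact: JM.
exists b => Q JQ; have : P %| Q.
  by apply: contra_notT dvdP => ndvd; exists Q.
by move/dvdpP=> [q ->]; rewrite rootM rootb orbT.
Qed.

(** * Splitting off the last variable *)

Definition extend_point (T : Type) (n : nat) (a : 'I_n -> T) (b : T) :
  'I_n.+1 -> T := fun i => oapp a b (unlift ord_max i).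

Lemma extend_point_max (T : Type) n (a : 'I_n -> T) b :
  extend_point a b ord_max = b.
Proof. by rewrite /extend_point unlift_none. Qed.

Lemma lift_ord_max n (i : 'I_n) : lift ord_max i = widen_ord (leqnSn n) i.
Proof. by apply: val_inj; rewrite /= /bump leqNgt ltn_ord. Qed.

Lemma extend_point_widen (T : Type) n (a : 'I_n -> T) b i :
  extend_point a b (widen_ord (leqnSn n) i) = a i.
Proof. by rewrite -lift_ord_max /extend_point liftK. Qed.

(** The isomorphism k[x_0..x_(n-1)][X] -> k[x_0..x_n], written as an evaluation
    so that it is a ring morphism by composition. *)
Definition multi (k : comNzRingType) (n : nat) (P : {poly {mpoly k[n]}}) :
  {mpoly k[n.+1]} := (map_poly (@mwiden n k) P).['X_ord_max].

Lemma multi_muni (k : comNzRingType) (n : nat) (f : {mpoly k[n.+1]}) :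
  multi (muni f) = f.
Proof.
rewrite [RHS]mpolyE muniE /multi !rmorph_sum /= horner_sum.
apply: eq_bigr => m _.
rewrite -mul_polyC rmorphM /= map_polyXn map_polyC hornerM hornerC hornerXn /=.
rewrite mwidenZ mwidenX -scalerAl mpolyXn -mpolyXD; congr (_ *: 'X_[_]).
apply/mnmP=> i; rewrite mnmDE mulmnE mnm1E.
case: (unliftP ord_max i) => [j ->|->].
  rewrite lift_ord_max mnmwiden_widen mnmE -val_eqE /= gtn_eqF //= addn0 //.
by rewrite mnmwiden_ordmax eqxx mul1n.
Qed.

Lemma horner_map_muni (k : comNzRingType) (n : nat) (f : {mpoly k[n.+1]}) a b :
  (map_poly (meval a) (muni f)).[b] = f.@[extend_point a b].
Proof.
rewrite mevalE muniE rmorph_sum /= horner_sum; apply: eq_bigr => m _.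
rewrite -mul_polyC rmorphM /= map_polyXn map_polyC hornerM hornerC hornerXn /=.
rewrite mevalZ mevalX big_ord_recr /= extend_point_max mulrA.
congr (_ * _ * _); apply: eq_bigr => i _; by rewrite extend_point_widen mnmE.
Qed.


(** * The homogeneous Nullstellensatz *)

Definition homogeneous_ideal (k : comNzRingType) (n : nat)
    (I : {mpoly k[n]} -> Prop) : Prop :=
  is_ideal I /\ forall d p, I p -> I (pihomog mdeg d p).

Lemma mdeg_mnmwiden (n : nat) (m : 'X_{1..n}) : mdeg (mnmwiden m) = mdeg m.
Proof.
rewrite !mdegE big_ord_recr /= mnmwiden_ordmax addn0.
by apply: eq_bigr => i _; rewrite mnmwiden_widen.
Qed.

Lemma mwiden_pihomog (k : comNzRingType) (n e : nat) (p : {mpoly k[n]}) :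
  mwiden (pihomog mdeg e p) = pihomog mdeg e (mwiden p).
Proof.
rewrite [p]mpolyE (raddf_sum (pihomog mdeg e)) !(raddf_sum (@mwiden n k)).
rewrite (raddf_sum (pihomog mdeg e)) /=; apply: eq_bigr => m _.
rewrite mwidenZ !linearZ /= mwidenZ mwidenX !pihomogX /= mdeg_mnmwiden.
by case: ifP; rewrite ?mwidenX ?mwiden0.
Qed.

(** The point (0 : ... : 0 : 1), which is the centre of the projection that
    forgets the last variable. *)
Definition last_vertex (k : nzRingType) {n : nat} : 'I_n.+1 -> k :=
  extend_point (fun _ => 0) 1.

Lemma last_vertexP (k : idomainType) (n d : nat) (m : 'X_{1..n.+1}) :
    mdeg m = d ->
  m = (U_(ord_max) *+ d)%MM /\ 'X_[m].@[last_vertex k] = 1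
  \/ [/\ (m ord_max < d)%N, 'X_[m].@[last_vertex k] = 0
       & exists i : 'I_n, (U_(widen_ord (leqnSn n) i) <= m)%MM].
Proof.
move=> deg_m; rewrite mevalX.
have [j|m0] := pickP (fun j : 'I_n => m (widen_ord (leqnSn n) j) != 0%N).
  move=> mj; right; split.
  - rewrite -deg_m mdegE big_ord_recr /= -[X in (X < _)%N]add0n ltn_add2r.
    by rewrite (bigD1 j) //= addn_gt0 lt0n mj.
  - rewrite big_ord_recr /= (bigD1 j) //= /last_vertex extend_point_widen.
    by rewrite expr0n (negPf mj) !mul0r.
  - by exists j; rewrite lep1mP.
left; have m_max : m ord_max = d.
  rewrite -deg_m mdegE big_ord_recr /= big1 ?add0n // => i _.
  by apply/eqP; apply: negbFE; exact: m0.
split.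
  apply/mnmP=> i; rewrite mulmnE mnm1E.
  case: (unliftP ord_max i) => [j ->|->]; last by rewrite eqxx mul1n.
  rewrite lift_ord_max -val_eqE /= gtn_eqF //= mul0n.
  by apply/eqP; apply: negbFE; exact: m0.
rewrite big_ord_recr /= /last_vertex extend_point_max expr1n mulr1.
rewrite big1 // => i _; rewrite extend_point_widen expr0n.
by have /negbFE-> := m0 i.
Qed.

(** This is why no change of coordinates is needed before eliminating: a form
    that does not vanish at the centre of projection is, after scaling, monic
    in the last variable. *)
Lemma muni_monic (k : fieldType) (n d : nat) (g : {mpoly k[n.+1]}) :
  g \is d.-homog -> g.@[last_vertex k] = 1 -> muni g \is monic.
Proof.
move=> hg g1; suff sz : (size (muni g - 'X^d)%R <= d)%N.
  rewrite -(subrK ('X^d) (muni g)) addrC monicE lead_coefDl ?lead_coefXn //.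
  by rewrite size_polyXn ltnS.
have -> : 'X^d = \sum_(m <- msupp g)
    ((g@_m * 'X_[m].@[last_vertex k])%:MP *: 'X^d) :> {poly {mpoly k[n]}}.
  rewrite -scaler_suml -rmorph_sum /=.
  under eq_bigr do rewrite mevalX.
  by rewrite -mevalE g1 mpolyC1 scale1r.
rewrite muniE -sumrB big_seq; apply: (leq_trans (size_sum _ _ _)).
apply/bigmax_leqP_seq=> m _ m_g.
have [[-> ->]|[lt_md -> _]] := last_vertexP k (dhomog_mf hg m_g).
  rewrite mulr1 mulmnE mnm1E eqxx mul1n -scalerBl.
  rewrite [X in 'X_[X]](_ : _ = 0%MM).
    by rewrite mpolyX0 alg_mpolyC subrr scale0r size_poly0.
  apply/mnmP=> i; rewrite mnmE mulmnE mnm1E mnm0E -val_eqE /= gtn_eqF //.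
rewrite mulr0 mpolyC0 scale0r subr0.
by rewrite (leq_trans (size_scale_leq _ _)) // size_polyXn.
Qed.

Definition radical (R : comNzRingType) (I : R -> Prop) (p : R) : Prop :=
  exists N, I (p ^+ N).

Lemma radical_ideal (R : comNzRingType) (I : R -> Prop) :
  is_ideal I -> is_ideal (radical I).
Proof.
move=> idI; have [I0 ID IM] := idI; split; first by exists 1%N.
  move=> p q [a Ia] [b Ib]; exists (a + b)%N; rewrite exprDn.
  apply: ideal_sum => // i _; rewrite -mulr_natl; apply: (IM).
  have [le_bi|lt_ib] := leqP b i.
    by rewrite -(subnK le_bi) exprD mulrA; apply: IM.
  have le_a : (a <= a + b - i)%N by rewrite -addnBA ?leq_addr // ltnW.
  by rewrite -(subnK le_a) exprD mulrC mulrA; apply: IM.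
by move=> a p [N IN]; exists N; rewrite exprMn; apply: IM.
Qed.

(** Induction on the number of variables, projecting from the last vertex.
    The vertex is not a zero of I, so I contains a form g monic in the last
    variable.  The ideal I' of the elements of I free of this variable has no
    zero either: over a zero a of I', the restrictions of I to the line
    (a, b), b in k, form an ideal of k[X]; if it has a common root b then (a, b)
    is a zero of I, and otherwise it contains 1 and [elimination_ideal] produces an
    element of I' that takes the value 1 at a.  By induction the first n
    variables are nilpotent modulo I; then g = 0 makes the last one nilpotent
    too. *)
Theorem projective_nullstellensatz (k : closedFieldType) (n : nat)
    (I : {mpoly k[n]} -> Prop) :
    homogeneous_ideal I ->
    (forall x : 'I_n -> k, (exists i, x i != 0) ->
       exists2 f, I f & f.@[x] != 0) ->
  forall i, radical I 'X_i.
Proof.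
elim: n => [|n IHn] in I *; first by move=> _ _ [].
move=> [idI homI] noz; have [I0 ID IM] := idI.
have [d [g [Ig hg g1]]] : exists d g,
    [/\ I g, g \is d.-homog & g.@[last_vertex k] = 1].
  have [|f If fv] := noz (last_vertex k).
    by exists ord_max; rewrite /last_vertex extend_point_max oner_neq0.
  have [d fd] : exists d, (pihomog mdeg d f).@[last_vertex k] != 0.
    apply: NNPP => fd0; move/eqP: fv; apply.
    rewrite (pihomog_partitionE (leqnn (msize f))) raddf_sum /= big1 // => d _.
    by apply/eqP; apply: contra_notT fd0 => ?; exists d.
  exists d, ((pihomog mdeg d f).@[last_vertex k]^-1 *: pihomog mdeg d f).
  split; last by rewrite mevalZ mulVf.
    by rewrite -mul_mpolyC; apply/IM/homI.
  exact/dhomogZ/pihomogP.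
pose I' (h : {mpoly k[n]}) := I (mwiden h).
pose J P := I (multi P).
have idJ : is_ideal J.
  rewrite /J /multi; split; first by rewrite rmorph0 horner0.
    by move=> p q Ip Iq; rewrite rmorphD hornerD; apply: ID.
  by move=> a p Ip; rewrite rmorphM hornerM; apply: IM.
have Jmuni f : I f -> J (muni f) by rewrite /J multi_muni.
have JC h : J h%:P -> I' h by rewrite /J /multi map_polyC hornerC.
have hI' : homogeneous_ideal I'.
  split; first split; rewrite /I'.
  - by rewrite mwiden0.
  - by move=> p q; rewrite mwidenD; apply: ID.
  - by move=> a p; rewrite mwidenM; apply: IM.
  by move=> e p Ip; rewrite mwiden_pihomog; apply: homI.
have noz' : forall a : 'I_n -> k, (exists i, a i != 0) ->
    exists2 h, I' h & h.@[a] != 0.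
  move=> a [i ai].
  pose Ja (Q : {poly k}) := exists2 P, J P & map_poly (meval a) P = Q.
  have idJa : is_ideal Ja.
    have [J0 JD JM] := idJ; split; first by exists 0; rewrite ?rmorph0.
      move=> _ _ [P JP <-] [Q JQ <-]; exists (P + Q); last by rewrite rmorphD.
      exact: JD.
    move=> A _ [P JP <-].
    exists (map_poly (@mpolyC n k) A * P); first exact: JM.
    rewrite rmorphM /= -map_poly_comp map_poly_id // => c _ /=.
    by rewrite mevalC.
  case: (classic (Ja 1)) => [[P JP P1]|nJa1].
    have [h Jh h1] :=
      elimination_ideal idJ (muni_monic hg g1) (Jmuni _ Ig) JP P1.
    by exists h; [exact: JC | rewrite h1 oner_neq0].
  have [b rootb] := ideal_common_root idJa nJa1.
  have [|f If fx] := noz (extend_point a b).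
    by exists (widen_ord (leqnSn n) i); rewrite extend_point_widen.
  have /rootb : Ja (map_poly (meval a) (muni f)) by exists (muni f); auto.
  by rewrite rootE horner_map_muni (negPf fx).
have idR := radical_ideal idI; have [R0 RD RM] := idR.
have radw i : radical I 'X_(widen_ord (leqnSn n) i).
  have [N IN] := IHn _ hI' noz' i; exists N.
  by move: IN; rewrite /I' rmorphXn /= mwidenX mnmwiden1.
move=> i; case: (unliftP ord_max i) => [j ->|->].
  by rewrite lift_ord_max.
(* Modulo I, the power 'X_ord_max ^+ d is minus the sum of the other terms of
   g, each of which contains one of the first n variables. *)
suff [M IM'] : radical I ('X_ord_max ^+ d) by exists (d * M)%N; rewrite exprM.
have -> : 'X_ord_max ^+ d = g + -1 * (\sum_(m <- msupp g)
   (g@_m)%:MP * ('X_[m] - ('X_[m].@[last_vertex k])%:MP * 'X_ord_max ^+ d)).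
  under eq_bigr do rewrite mulrBr mulrA -mpolyCM mul_mpolyC.
  rewrite sumrB -mpolyE -mulr_suml -rmorph_sum /=.
  under eq_bigr do rewrite mevalX.
  by rewrite -mevalE g1 mul1r mulN1r opprB addrC subrK.
apply: RD; first by exists 1%N.
apply: (RM); rewrite big_seq; apply: ideal_sum => // m m_g; apply: (RM).
have [[-> ->]|[_ -> [j le_jm]]] := last_vertexP k (dhomog_mf hg m_g).
  by rewrite mpolyC1 mul1r mpolyXn subrr.
by rewrite mpolyC0 mul0r subr0 -(submK le_jm) mpolyXD; apply: RM.
Qed.

(** * Common zeros of few forms *)

(** Stated for two finite families in an arbitrary module, because the
    polynomial ring has infinite dimension. *)
Lemma span_card (K : fieldType) (V : lmodType K) (S T : finType)
    (u : S -> V) (g : T -> V) :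
    (forall s, exists c : T -> K, u s = \sum_t c t *: g t) ->
    (forall v : S -> K, \sum_s v s *: u s = 0 -> forall s, v s = 0) ->
  (#|S| <= #|T|)%N.
Proof.
move=> /fin_all_exists[c uE] free_u; rewrite leqNgt; apply/negP => lt_TS.
pose M := \matrix_(i < #|S|, j < #|T|) c (enum_val i) (enum_val j).
have [i kerM] : exists i, row i (kermx M) != 0.
  apply/existsP; rewrite -negb_forall; apply: contraL lt_TS => /forallP ker0.
  rewrite -leqNgt; have : row_free M; last first.
    by rewrite -row_leq_rank => /leq_trans-> //; exact: rank_leq_col.
  rewrite -kermx_eq0; apply/eqP/row_matrixP => i; rewrite row0; apply/eqP.
  by rewrite -[_ == _]negbK ker0.
have vM : row i (kermx M) *m M = 0 by rewrite -row_mul mulmx_ker row0.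
move: (row i _) kerM vM => v nzv vM; case/eqP: nzv.
apply/rowP => j; rewrite mxE -(enum_valK j).
apply: (free_u (fun s => v 0 (enum_rank s))).
under eq_bigr do rewrite uE scaler_sumr.
rewrite exchange_big big1 //= => t _.
under eq_bigr do rewrite scalerA.
rewrite -scaler_suml (_ : \sum_s _ = (v *m M) 0 (enum_rank t)); last first.
  rewrite mxE (reindex_onto enum_rank enum_val) /=; last first.
    by move=> s _; rewrite enum_valK.
  apply: eq_big => [s|s _]; first by rewrite enum_rankK eqxx.
  by rewrite mxE !enum_rankK.
by rewrite vM mxE scale0r.
Qed.

Definition forms_ideal (k : comNzRingType) (n r : nat)
    (f : 'I_r -> {mpoly k[n]}) (p : {mpoly k[n]}) : Prop :=
  exists a : 'I_r -> {mpoly k[n]}, p = \sum_j a j * f j.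

Lemma pihomogM_form (k : comNzRingType) (n d e : nat) (a f : {mpoly k[n]}) :
  f \is d.-homog ->
  pihomog mdeg e (a * f) = if (d <= e)%N then pihomog mdeg (e - d) a * f else 0.
Proof.
move=> hf; rewrite [a in LHS](pihomog_partitionE (leq_maxl (msize a) e.+1)).
rewrite mulr_suml raddf_sum /=.
have piM i : pihomog mdeg e (pihomog mdeg i a * f) =
    if (i + d == e)%N then pihomog mdeg i a * f else 0.
  have hM : pihomog mdeg i a * f \is (i + d).-homog.
    by apply: dhomogM => //; apply: pihomogP.
  by case: eqVneq => [<-|?]; [exact: pihomog_dE | exact: pihomog_ne0 hM].
under eq_bigr do rewrite piM.
case: leqP => [le_de|lt_ed]; last first.
  rewrite big1 // => i _; case: eqP => // def_e.
  by move: lt_ed; rewrite ltnNge -[X in (_ <= X)%N]def_e leq_addl.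
have lt_ed : (e - d < maxn (msize a) e.+1)%N.
  by rewrite leq_max ltnS leq_subr orbT.
rewrite (bigD1 (Ordinal lt_ed)) //= subnK // eqxx big1 ?addr0 // => i ne.
case: eqP => // def_e; case/eqP: ne; apply: val_inj => /=.
by rewrite -[X in (X - _)%N]def_e addnK.
Qed.

Lemma forms_ideal_homogeneous (k : comNzRingType) (n r : nat)
    (d : 'I_r -> nat) (f : 'I_r -> {mpoly k[n]}) :
  (forall j, f j \is (d j).-homog) -> homogeneous_ideal (forms_ideal f).
Proof.
move=> hf; split; first split.
- by exists (fun=> 0); rewrite big1 // => j _; rewrite mul0r.
- move=> _ _ [a ->] [b ->]; exists (fun j => a j + b j).
  by rewrite -big_split; apply: eq_bigr => j _; rewrite mulrDl.
- move=> c _ [a ->]; exists (fun j => c * a j).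
  by rewrite mulr_sumr; apply: eq_bigr => j _; rewrite mulrA.
move=> e _ [a ->].
exists (fun j => if (d j <= e)%N then pihomog mdeg (e - d j) (a j) else 0).
rewrite (raddf_sum (pihomog mdeg e)) /=; apply: eq_bigr => j _.
by rewrite (pihomogM_form _ _ (hf j)); case: ifP; rewrite ?mul0r.
Qed.

(** When all X_i^N lie in the ideal of f, these products span the polynomial
    ring: it is a finitely generated module over k[f_1, ..., f_r].  The bound D
    on the exponents of the forms makes the family finite. *)
Definition reduced_term (k : comNzRingType) (n r N D : nat)
    (f : 'I_r -> {mpoly k[n]})
    (t : {ffun 'I_n -> 'I_N} * {ffun 'I_r -> 'I_D.+1}) : {mpoly k[n]} :=
  'X_[[multinom (t.1 i : nat) | i < n]] * \prod_j f j ^+ t.2 j.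

Definition reduced_span (k : comNzRingType) (n r N D : nat)
    (f : 'I_r -> {mpoly k[n]}) (p : {mpoly k[n]}) : Prop :=
  exists c : {ffun 'I_n -> 'I_N} * {ffun 'I_r -> 'I_D.+1} -> k,
    p = \sum_t c t *: reduced_term f t.

Section ReducedSpan.
Variables (k : comNzRingType) (n r N : nat) (f : 'I_r -> {mpoly k[n]}).

Lemma reduced_span0 D : reduced_span N D f 0.
Proof. by exists (fun=> 0); rewrite big1 // => t _; rewrite scale0r. Qed.

Lemma reduced_spanD D p q :
  reduced_span N D f p -> reduced_span N D f q -> reduced_span N D f (p + q).
Proof.
move=> [a ->] [b ->]; exists (fun t => a t + b t).
by rewrite -big_split; apply: eq_bigr => t _; rewrite scalerDl.
Qed.

Lemma reduced_spanZ D c p : reduced_span N D f p -> reduced_span N D f (c *: p).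
Proof.
move=> [a ->]; exists (fun t => c * a t).
by rewrite scaler_sumr; apply: eq_bigr => t _; rewrite scalerA.
Qed.

Lemma reduced_span_sum D (T : Type) (s : seq T) (P : pred T)
    (F : T -> {mpoly k[n]}) :
  (forall i, P i -> reduced_span N D f (F i)) ->
  reduced_span N D f (\sum_(i <- s | P i) F i).
Proof.
move=> spanF; apply: (big_ind (reduced_span N D f)) => //.
  exact: reduced_span0.
exact: reduced_spanD.
Qed.

Lemma reduced_span_term D (t : {ffun 'I_n -> 'I_N} * {ffun 'I_r -> 'I_D.+1}) :
  reduced_span N D f (reduced_term f t).
Proof.
exists (fun s => (s == t)%:R); rewrite (bigD1 t) //= eqxx scale1r big1 ?addr0 //.
by move=> s /negPf->; rewrite scale0r.
Qed.

Lemma reduced_spanM D j p :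
  reduced_span N D f p -> reduced_span N D.+1 f (p * f j).
Proof.
move=> [c ->]; rewrite mulr_suml; apply: reduced_span_sum => -[b e] _.
rewrite -scalerAl; apply: reduced_spanZ.
pose e' := [ffun i => inord (e i + (i == j)) : 'I_D.+2].
rewrite (_ : _ * f j = reduced_term f (b, e')); first exact: reduced_span_term.
rewrite /reduced_term /= -mulrA; congr (_ * _).
have e'E i : e' i = (e i + (i == j))%N :> nat.
  rewrite ffunE inordK // -[D.+2]addn1 -addSn leq_add ?leq_b1 //.
under [RHS]eq_bigr do rewrite e'E exprD.
rewrite big_split /=; congr (_ * _).
by rewrite (bigD1 j) //= eqxx expr1 big1 ?mulr1 // => i /negPf->.
Qed.

(** Induction on the degree: a monomial with an exponent at least N is divisible
    by some X_i^N, and the degree-N part of X_i^N = sum_j a_j f_j writes it as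
    a combination of the f_j with coefficients of smaller degree. *)
Lemma reduced_span_degree (d : 'I_r -> nat) :
    (0 < N)%N -> (forall j, (0 < d j)%N) -> (forall j, f j \is (d j).-homog) ->
    (forall i, forms_ideal f ('X_i ^+ N)) ->
  forall D p, (msize p <= D.+1)%N -> reduced_span N D f p.
Proof.
move=> N0 d0 hf fN; have homI := forms_ideal_homogeneous hf.
elim=> [|D IHD] p le_p.
  have -> : p = p@_0%MM *: reduced_term f
      ([ffun=> Ordinal N0], [ffun=> ord0] : {ffun _ -> 'I_1}).
    rewrite [LHS](msize1_polyC le_p) /reduced_term -alg_mpolyC; congr (_ *: _).
    rewrite [X in 'X_[X]](_ : _ = 0%MM) ?mpolyX0 ?mul1r.
      by rewrite big1 // => j _; rewrite ffunE expr0.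
    by apply/mnmP=> i; rewrite mnmE ffunE mnm0E.
  exact/reduced_spanZ/reduced_span_term.
rewrite [p]mpolyE big_seq; apply: reduced_span_sum => m m_p; apply: reduced_spanZ.
have {le_p m_p p} deg_m : (mdeg m <= D.+1)%N.
  by rewrite -ltnS (leq_trans _ le_p) // msize_mdeg_lt.
have [i le_Nm|small] := pickP (fun i => (N <= m i)%N); last first.
  have ltmN i : (m i < N)%N by rewrite ltnNge small.
  rewrite (_ : 'X_[m] = reduced_term f
    ([ffun i => Ordinal (ltmN i)], [ffun=> ord0] : {ffun _ -> 'I_D.+2})).
    exact: reduced_span_term.
  rewrite /reduced_term [X in _ * X]big1 ?mulr1.
    by congr 'X_[_]; apply/mnmP => i; rewrite mnmE ffunE.
  by move=> j _; rewrite ffunE expr0.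
have le_m : (U_(i) *+ N <= m)%MM.
  apply/mnm_lepP => j; rewrite mulmnE mnm1E.
  by case: eqP => [<-|]; rewrite ?mul1n.
have [a XN] := fN i.
have hXN : ('X_i ^+ N : {mpoly k[n]}) \is N.-homog.
  by rewrite mpolyXn dhomogX /= mdegMn mdeg1 mul1n.
rewrite -(submK le_m) mpolyXD -mpolyXn -(pihomog_dE hXN) XN.
rewrite (raddf_sum (pihomog mdeg N)) /=.
rewrite mulr_sumr; apply: reduced_span_sum => j _.
rewrite (pihomogM_form _ _ (hf j)); case: leqP => [le_dN|_]; last first.
  by rewrite mulr0; exact: reduced_span0.
rewrite mulrA; apply/reduced_spanM/IHD.
have hP : 'X_[m - U_(i) *+ N] * pihomog mdeg (N - d j) (a j)
    \is (mdeg (m - U_(i) *+ N)%MM + (N - d j)).-homog.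
  by apply: dhomogM; [rewrite dhomogX | exact: pihomogP].
rewrite msizeE; apply/bigmax_leqP_seq => m' m'P _; rewrite (dhomog_mf hP m'P).
rewrite ltnS -ltnS (leq_trans _ deg_m) //.
rewrite -{2}(submK le_m) mdegD ltn_add2l mdegMn mdeg1 mul1n.
by rewrite ltn_subrL d0 N0.
Qed.

End ReducedSpan.

Lemma monomials_free (k : fieldType) (n E : nat) (v : {ffun 'I_n -> 'I_E} -> k) :
    \sum_s v s *: 'X_[[multinom (s i : nat) | i < n]] = 0 :> {mpoly k[n]} ->
  forall s, v s = 0.
Proof.
move=> v0 s; have := congr1 (mcoeff [multinom (s i : nat) | i < n]) v0.
rewrite raddf_sum mcoeff0 (bigD1 s) //= mcoeffZ mcoeffX eqxx mulr1.
rewrite big1 ?addr0 //.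
move=> t ne_ts; rewrite mcoeffZ mcoeffX.
case: eqP => [eq_ts|]; last by rewrite mulr0.
case/eqP: ne_ts; apply/ffunP => i; apply: val_inj.
by have /mnmP/(_ i) := eq_ts; rewrite !mnmE.
Qed.

(** If there were no such zero, the (E+1)^n monomials with exponents at most E,
    which have degree at most nE, would lie in the span of the
    N^n (nE+1)^r reduced terms, for every E. *)
Theorem forms_common_zero (k : closedFieldType) (n r : nat)
    (d : 'I_r -> nat) (f : 'I_r -> {mpoly k[n]}) :
    (r < n)%N -> (forall j, (0 < d j)%N) -> (forall j, f j \is (d j).-homog) ->
  exists2 x : 'I_n -> k, (exists i, x i != 0) & forall j, (f j).@[x] = 0.
Proof.
move=> lt_rn d0 hf; apply: NNPP => noz.
have homI := forms_ideal_homogeneous hf; have [[_ _ IM] _] := homI.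
have nozI (x : 'I_n -> k) : (exists i, x i != 0) ->
    exists2 p, forms_ideal f p & p.@[x] != 0.
  move=> nzx; apply: NNPP => Ix0; apply: noz; exists x => // j.
  apply/eqP; apply: contra_notT Ix0 => fj; exists (f j) => //.
  exists (fun i => (i == j)%:R); rewrite (bigD1 j) //= eqxx mul1r big1 ?addr0 //.
  by move=> i /negPf->; rewrite mul0r.
have [N0 XN0] := fin_all_exists (projective_nullstellensatz homI nozI).
pose N := (\max_i N0 i).+1.
have XN i : forms_ideal f ('X_i ^+ N).
  have le_N : (N0 i <= N)%N by rewrite ltnW // ltnS leq_bigmax.
  by rewrite -(subnK le_N) exprD; apply: IM.
(* As nE + 1 <= n (E + 1), there are at most N^n n^r (E+1)^r reduced terms.
   With this choice of E that number is E (E+1)^r, which is less than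
   (E+1)^(r+1) and hence than (E+1)^n. *)
pose E := (N ^ n * n ^ r)%N.
have : (#|{: {ffun 'I_n -> 'I_E.+1}}|
      <= #|{: {ffun 'I_n -> 'I_N} * {ffun 'I_r -> 'I_(n * E).+1}}|)%N.
  apply: (span_card (g := @reduced_term k n r N (n * E) f)
    (u := fun s : {ffun 'I_n -> 'I_E.+1} =>
            'X_[[multinom (s i : nat) | i < n]])).
    move=> s; apply: (reduced_span_degree _ d0 hf XN) => //.
    rewrite msizeX ltnS mdegE -[n in (n * E)%N]card_ord -sum_nat_const.
    by apply: leq_sum => i _; rewrite mnmE -ltnS.
  by move=> v; apply: monomials_free.
rewrite card_prod !card_ffun !card_ord leqNgt => /negP; apply.
have n0 : (0 < n)%N by apply: leq_ltn_trans lt_rn.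
have le1 : ((n * E).+1 ^ r <= n ^ r * E.+1 ^ r)%N.
  have le_nE : ((n * E).+1 <= n * E.+1)%N.
    by rewrite mulnS addnC -addn1 leq_add2l.
  by rewrite -expnMn; case: (r) => // r'; rewrite leq_exp2r.
apply: leq_ltn_trans (leq_mul (leqnn _) le1) _.
rewrite mulnA -/E; apply: leq_trans (_ : E.+1 ^ r.+1 <= _)%N; last first.
  exact: leq_pexp2l.
by rewrite expnS ltn_pmul2r // expn_gt0.
Qed.

(** * Global sections of O(d) *)

(** An algebraically closed field is infinite: a nonzero polynomial that
    vanished everywhere would make P + 1 a nonconstant polynomial without
    roots. *)
Lemma poly_eq0_fun (k : closedFieldType) (P : {poly k}) :
  (forall t, P.[t] = 0) -> P = 0.
Proof.
move=> P0; have : size (P + 1) == 1.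
  apply: contraT => /closed_rootP[t]; rewrite rootE hornerD P0 hornerC add0r.
  by rewrite oner_eq0.
case/size_poly1P=> c _ /(canRL (addrK _)); rewrite -polyCB => defP.
by move: (P0 0); rewrite defP hornerC => ->.
Qed.

Lemma poly_eq_fun (k : closedFieldType) (P Q : {poly k}) :
  (forall t, t != 0 -> P.[t] = Q.[t]) -> P = Q.
Proof.
move=> PQ; apply/eqP; rewrite -subr_eq0.
suff /eqP : 'X * (P - Q) = 0 by rewrite mulf_eq0 polyX_eq0.
apply: poly_eq0_fun => t; rewrite hornerM hornerX hornerD hornerN.
by have [->|/PQ->] := eqVneq t 0; rewrite ?mul0r ?subrr ?mulr0.
Qed.

(** Near 0, phi is a quotient P / Q in lowest terms.  Any other local quotient
    P1 / Q1 satisfies P Q1 = P1 Q, so a zero of Q where Q1 does not vanish would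
    be a zero of P too.  Hence Q has no zero and is constant. *)
Lemma regular_on_affine_line (k : closedFieldType) (phi : k -> k) :
    (forall t0, exists P Q : {poly k}, Q.[t0] != 0 /\
       forall t, Q.[t] != 0 -> phi t = P.[t] / Q.[t]) ->
  exists F : {poly k}, forall t, phi t = F.[t].
Proof.
move=> reg; have [P0 [Q0 [Q00 phiP0]]] := reg 0.
have nzQ0 : Q0 != 0 by apply: contraNneq Q00 => ->; rewrite horner0.
have nzD : gcdp P0 Q0 != 0 by rewrite gcdp_eq0 (negPf nzQ0) andbF.
have coPQ : coprimep (P0 %/ gcdp P0 Q0) (Q0 %/ gcdp P0 Q0).
  by rewrite coprimep_div_gcd // nzQ0 orbT.
have defP := divpK (dvdp_gcdl P0 Q0); have defQ := divpK (dvdp_gcdr P0 Q0).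
move: (_ %/ _) (_ %/ _) coPQ defP defQ => Q P coPQ defP defQ.
have cross P1 Q1 : Q1 != 0 ->
    (forall t, Q1.[t] != 0 -> phi t = P1.[t] / Q1.[t]) -> P * Q1 = P1 * Q.
  move=> nzQ1 phiP1; apply: (mulfI nzD).
  rewrite !mulrA [_ * P]mulrC defP mulrAC [_ * Q]mulrC defQ [Q0 * _]mulrC.
  apply: (mulfI (mulf_neq0 nzQ0 nzQ1)); apply/eqP; rewrite -subr_eq0; apply/eqP.
  apply: poly_eq0_fun => t; rewrite !(hornerD, hornerN, hornerM).
  have [->|Q0t] := eqVneq Q0.[t] 0; first by rewrite !(mul0r, mulr0, subr0).
  have [->|Q1t] := eqVneq Q1.[t] 0; first by rewrite !(mul0r, mulr0, subr0).
  apply/eqP; rewrite subr_eq0 (inj_eq (mulfI (mulf_neq0 Q0t Q1t))).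
  by rewrite -eqr_div // -phiP0 // phiP1.
have /size_poly1P[c nzc defc] : size Q == 1.
  apply: contraT => /closed_rootP[t1 Qt1].
  have [P1 [Q1 [Q1t phiP1]]] := reg t1.
  have nzQ1 : Q1 != 0 by apply: contraNneq Q1t => ->; rewrite horner0.
  have /(congr1 (fun R : {poly k} => R.[t1])) := cross _ _ nzQ1 phiP1.
  rewrite !hornerM (rootP Qt1) mulr0 => /eqP; rewrite mulf_eq0 (negPf Q1t) orbF.
  by move=> Pt1; have := coprimep_root coPQ Pt1; rewrite (rootP Qt1) eqxx.
exists (c^-1 *: P) => t; have [P1 [Q1 [Q1t phiP1]]] := reg t.
have nzQ1 : Q1 != 0 by apply: contraNneq Q1t => ->; rewrite horner0.
have /(congr1 (fun R : {poly k} => R.[t])) := cross _ _ nzQ1 phiP1.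
rewrite !hornerM defc hornerC hornerZ phiP1 // => PQ.
by apply: (mulIf Q1t); rewrite divfK // -mulrA PQ mulrC mulfK.
Qed.

Definition line_poly (k : comNzRingType) (n : nat) (x y : 'rV[k]_n)
    (p : {mpoly k[n]}) : {poly k} :=
  mmap (@polyC k) (fun i => (x 0 i)%:P + (y 0 i)%:P * 'X) p.

Lemma horner_line_poly (k : comNzRingType) (n : nat) (x y : 'rV[k]_n)
    (p : {mpoly k[n]}) t : (line_poly x y p).[t] = p.@[(x + t *: y) 0].
Proof.
rewrite mevalE /line_poly /mmap horner_sum; apply: eq_bigr => m _.
rewrite hornerM hornerC /mmap1 horner_prod; congr (_ * _); apply: eq_bigr => i _.
by rewrite horner_exp hornerD hornerC hornerM hornerC hornerX !mxE mulrC.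
Qed.

Lemma meval_dhomog (k : comNzRingType) (n e : nat) (p : {mpoly k[n]}) l
    (x : 'rV[k]_n) : p \is e.-homog -> p.@[(l *: x) 0] = l ^+ e * p.@[x 0].
Proof.
move=> hp; rewrite !mevalE big_seq [in RHS]big_seq mulr_sumr.
apply: eq_bigr => m /(dhomog_mf hp) deg_m.
under eq_bigr do rewrite mxE exprMn.
by rewrite big_split /= prodrXr -mdegE deg_m mulrCA.
Qed.

Section GlobalSection.
Variables (k : closedFieldType) (n d : nat) (s : 'rV[k]_n.+1 -> k).
Hypothesis sec_s : twist_section (@projective_space k n) d s.

Lemma global_section_scale l x : l != 0 -> x != 0 -> s (l *: x) = l ^+ d * s x.
Proof.
move=> nzl nzx; have [e [f [p [q [hp hq ef qx spq]]]]] := sec_s nzx.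
have nzlx : l *: x != 0 by rewrite scaler_eq0 negb_or nzl.
have def_e : e = (f + d)%N by apply/eqP; rewrite -eqz_nat ef.
rewrite (spq _ nzx qx) spq //; last first.
  by rewrite (meval_dhomog _ _ hq) mulf_neq0 // expf_neq0.
rewrite (meval_dhomog _ _ hp) (meval_dhomog _ _ hq) def_e exprD.
by rewrite -[l ^+ f * _ * _]mulrA -mulf_div divff ?expf_neq0 // mul1r mulrA.
Qed.

Lemma global_section_line_regular x y : (forall t, x + t *: y != 0) ->
  exists F : {poly k}, forall t, s (x + t *: y) = F.[t].
Proof.
move=> nz; apply: regular_on_affine_line => t0.
have [e [f [p [q [_ _ _ qx spq]]]]] := sec_s (nz t0).
exists (line_poly x y p), (line_poly x y q).
rewrite horner_line_poly; split=> // t.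
by rewrite !horner_line_poly => /(spq _ (nz t)).
Qed.

(** The restrictions F and G of s to the two affine charts t |-> x + t y and
    t |-> y + t x of the line are polynomials, and homogeneity gives
    F(t) = t^d G(1/t) for t != 0; comparing degrees bounds that of F. *)
Lemma global_section_line x y : y != 0 -> (forall t, x + t *: y != 0) ->
  exists2 F : {poly k}, (size F <= d.+1)%N & forall t, s (x + t *: y) = F.[t].
Proof.
move=> nzy nz; have [F sF] := global_section_line_regular nz; exists F => //.
have nz' t : y + t *: x != 0.
  have [->|nzt] := eqVneq t 0; first by rewrite scale0r addr0.
  apply: contraNneq (nz t^-1) => yx.
  by rewrite -[x]scale1r -(mulVf nzt) -scalerA -scalerDr addrC yx scaler0.
have [G sG] := global_section_line_regular nz'.
(* R is t^(size G) G(1/t), the reciprocal polynomial of G times t. *)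
pose R := \sum_(i < size G) G`_i *: 'X^(size G - i).
have sizeR : (size R <= (size G).+1)%N.
  apply: (leq_trans (size_sum _ _ _)); apply/bigmax_leqP => i _.
  by rewrite (leq_trans (size_scale_leq _ _)) // size_polyXn ltnS leq_subr.
have FG : 'X^(size G) * F = 'X^d * R.
  apply: poly_eq_fun => t nzt; rewrite !hornerM !hornerXn -sF.
  have -> : x + t *: y = t *: (y + t^-1 *: x).
    by rewrite scalerDr scalerA mulfV // scale1r addrC.
  rewrite global_section_scale // sG mulrCA; congr (_ * _).
  rewrite horner_sum horner_coef mulr_sumr; apply: eq_bigr => i _.
  rewrite hornerZ hornerXn mulrCA exprVn; congr (_ * _).
  by rewrite -{1}(subnK (ltnW (ltn_ord i))) exprD mulfK // expf_neq0.
have [->|nzF] := eqVneq F 0; first by rewrite size_poly0.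
have := congr1 (fun P : {poly k} => size P) FG.
rewrite !size_monicM ?monicXn //; last first.
  apply: contraNneq nzF => R0; move/eqP: FG.
  by rewrite R0 mulr0 mulf_eq0 expf_eq0 polyX_eq0 andbF.
rewrite !size_polyXn !addSn /= => sz.
rewrite -(leq_add2l (size G)) sz addnC addnS -addSn.
by rewrite leq_add2r.
Qed.

End GlobalSection.

(** On the line through two independent vectors u and v, s is a polynomial of
    degree 0, so s u = s (u + v); by symmetry s v = s (u + v). *)
Lemma global_section0_constant (k : closedFieldType) (n : nat)
    (s : 'rV[k]_n.+1 -> k) x y :
  twist_section (@projective_space k n) 0 s -> x != 0 -> y != 0 -> s x = s y.
Proof.
move=> sec_s nzx nzy; case: (classic (exists l, y = l *: x)) => [[l def_y]|nyx].
  move: nzy; rewrite def_y scaler_eq0 negb_or => /andP[nzl _].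
  by rewrite (global_section_scale (d := 0) sec_s) // expr0 mul1r.
have sD u v : v != 0 -> (forall t, u + t *: v != 0) -> s u = s (u + v).
  move=> nzv /(global_section_line (d := 0) sec_s nzv)[F /size1_polyC-> sF].
  have := sF 1; have := sF 0; rewrite scale0r addr0 scale1r => -> ->.
  by rewrite !hornerC.
rewrite (sD x y) // => [|t]; first rewrite addrC -(sD y x) // => t.
  apply: contra_notN nyx => /eqP/addr0_eq/esym ytx; exists (- t).
  by rewrite scaleNr ytx opprK.
have [->|nzt] := eqVneq t 0; first by rewrite scale0r addr0.
apply: contra_notN nyx => /eqP/addr0_eq xty; exists (- t^-1).
by rewrite -[x]opprK xty scalerN scaleNr opprK scalerA mulVf ?scale1r.
Qed.

Definition set_coord (k : nzRingType) (n : nat) (x : 'rV[k]_n) i t : 'rV[k]_n :=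
  \row_j (if j == i then t else x 0 j).

(** Lagrange interpolation, one coordinate after the other.  The nodes 0, ..., N
    are distinct because the characteristic is zero. *)
Lemma coordinatewise_polynomial (k : fieldType) (n N : nat) (f : 'rV[k]_n -> k) :
    [pchar k] =i pred0 ->
    (forall x i, exists2 F : {poly k}, (size F <= N.+1)%N
       & forall t, f (set_coord x i t) = F.[t]) ->
  exists p : {mpoly k[n]}, forall x, f x = p.@[x 0].
Proof.
move=> char0 coordF.
have inj_a : injective (fun j => j%:R : k).
  move=> i j; wlog le_ij : i j / (i <= j)%N => [th|].
    by case/orP: (leq_total i j) => /th // th' /esym/th'->.
  move=> eq_ij; have := (pcharf0P k).1 char0 (j - i)%N.
  rewrite natrB // eq_ij subrr eqxx subn_eq0 => /esym le_ji.
  by apply/eqP; rewrite eqn_leq le_ij.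
pose mix i (x y : 'rV[k]_n) : 'rV[k]_n :=
  \row_j (if (j < i)%N then x 0 j else y 0 j).
(* Only the first i coordinates vary; the others are kept at those of y. *)
suff mixP i : (i <= n)%N -> forall y, exists p : {mpoly k[n]},
    forall x, f (mix i x y) = p.@[x 0].
  have [p fp] := mixP n (leqnn n) 0; exists p => x; rewrite -fp; congr f.
  by apply/rowP => j; rewrite mxE ltn_ord.
elim: i => [|i IHi] le_in y.
  exists (f y)%:MP => x; rewrite mevalC; congr f.
  by apply/rowP => j; rewrite mxE.
pose i0 := Ordinal le_in.
have /fin_all_exists[p fp] (j : 'I_N.+1) : exists pj : {mpoly k[n]}, forall x,
    f (mix i x (set_coord y i0 j%:R)) = pj.@[x 0].
  exact: IHi (ltnW le_in) _.
pose L := tnth (lagrange N.+1 (fun j => j%:R : k)).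
exists (\sum_j p j * (map_poly (@mpolyC n k) (L j : {poly k})).['X_i0]) => x.
have [F sF Ft] := coordF (mix i x y) i0.
have -> : mix i.+1 x y = set_coord (mix i x y) i0 (x 0 i0).
  apply/rowP => j; rewrite !mxE ltnS leq_eqVlt.
  have [->|ne_j] := eqVneq j i0; first by rewrite eqxx.
  by rewrite -[X in X || _]/(val j == val i0) val_eqE (negPf ne_j).
rewrite Ft {1}(lagrange_gen (ltn0Sn N) inj_a sF) horner_sum raddf_sum /=.
apply: eq_bigr => j _; rewrite hornerM hornerC mevalM; congr (_ * _).
  rewrite -fp -Ft; congr f; apply/rowP => l; rewrite !mxE.
  by case: eqP => // ->; rewrite ltnn.
rewrite -[in RHS]horner_map /= mevalXU -map_poly_comp map_poly_id // => c _ /=.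
by rewrite mevalC.
Qed.

(** Extended by 0 at the origin, s becomes a polynomial p by interpolation along
    the coordinate directions.  Since p (l x) = l^d p x for all l, only the
    component of degree d of p contributes to its values. *)
Theorem global_section_form (k : closedFieldType) (n d : nat)
    (s : 'rV[k]_n.+1 -> k) :
    [pchar k] =i pred0 -> (0 < d)%N ->
    twist_section (@projective_space k n) d s ->
  exists2 p : {mpoly k[n.+1]}, p \is d.-homog
    & forall x, x != 0 -> s x = p.@[x 0].
Proof.
move=> char0 d0 sec_s; pose g x := if x == 0 then 0 else s x.
have gs x : x != 0 -> g x = s x by rewrite /g => /negPf->.
have gZ l x : x != 0 -> g (l *: x) = l ^+ d * s x.
  move=> nzx; rewrite /g scaler_eq0 (negPf nzx) orbF; case: eqP => [->|/eqP nzl].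
    by rewrite expr0n eqn0Ngt d0 mul0r.
  exact: global_section_scale.
have [|p gp] := coordinatewise_polynomial (N := d) (f := g) char0.
  move=> x i; have nze : delta_mx 0 i != 0 :> 'rV[k]_n.+1.
    by apply/eqP => /rowP/(_ i)/eqP; rewrite !mxE !eqxx oner_eq0.
  have setE t : set_coord x i t = set_coord x i 0 + t *: delta_mx 0 i.
    apply/rowP => j; rewrite !mxE eqxx /=; case: eqP => _ /=.
      by rewrite mulr1 add0r.
    by rewrite mulr0 addr0.
  (* A coordinate line through the origin is handled by homogeneity alone;
     any other one avoids the origin and is a line in projective space. *)
  have [x0|nzx] := eqVneq (set_coord x i 0) 0.
    exists (s (delta_mx 0 i) *: 'X^d).
      by rewrite (leq_trans (size_scale_leq _ _)) // size_polyXn.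
    by move=> t; rewrite setE x0 add0r gZ // hornerZ hornerXn mulrC.
  have nz t : set_coord x i 0 + t *: delta_mx 0 i != 0.
    apply: contraNneq nzx => xt0; apply/eqP/rowP => j.
    have /rowP/(_ j) := xt0; rewrite !mxE; case: eqP => //= _.
    by rewrite mulr0 addr0.
  have [F sF Ft] := global_section_line sec_s nze nz.
  by exists F => // t; rewrite setE gs.
exists (pihomog mdeg d p); first exact: pihomogP.
move=> x nzx; set N := maxn (msize p) d.+1.
have ltdN : (d < N)%N by rewrite leq_max ltnSn orbT.
have : \sum_(e < N) (pihomog mdeg e p).@[x 0] *: 'X^e = s x *: 'X^d.
  apply: poly_eq_fun => l _; rewrite hornerZ hornerXn mulrC -gZ // gp.
  rewrite [p in RHS](pihomog_partitionE (leq_maxl (msize p) d.+1)).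
  rewrite raddf_sum horner_sum.
  apply: eq_bigr => e _ /=; rewrite hornerZ hornerXn mulrC.
  by rewrite (meval_dhomog _ _ (pihomogP _ _ _)).
move/(congr1 (fun P : {poly k} => P`_d)).
rewrite coefZ coefXn eqxx mulr1 => <-.
rewrite coef_sum (bigD1 (Ordinal ltdN)) //= coefZ coefXn eqxx mulr1.
rewrite big1 ?addr0 //.
move=> e; rewrite -val_eqE /= coefZ coefXn eq_sym => /negPf->.
by rewrite mulr0.
Qed.

(** * Subbundles and minimality *)

Definition coord_open (k : closedFieldType) (n : nat) (a : 'I_n.+1) :
  'rV[k]_n.+1 -> Prop := fun y => y 0 a != 0.

Section TwistSections.
Variables (k : closedFieldType) (n : nat).
Implicit Types (U : 'rV[k]_n.+1 -> Prop) (d : int) (s : 'rV[k]_n.+1 -> k).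

Lemma coord_open_neq0 (a : 'I_n.+1) (y : 'rV[k]_n.+1) :
  coord_open a y -> y != 0.
Proof. by move=> ya; apply/rV0Pn; exists a. Qed.

Lemma coord_open_zariski (a : 'I_n.+1) : zariski_open (@coord_open k n a).
Proof.
split=> [x|x xa]; first exact: coord_open_neq0.
exists 1%N, 'X_a; rewrite dhomogX /= mdeg1 mevalXU; split=> // y _.
by rewrite mevalXU.
Qed.

Lemma twist_section_sub U V d s : (forall x, U x -> V x) ->
  twist_section V d s -> twist_section U d s.
Proof.
move=> UV sec_s x Ux; have [e [f [p [q [hp hq ef qx spq]]]]] := sec_s x (UV x Ux).
by exists e, f, p, q; split=> // y /UV; apply: spq.
Qed.

Lemma twist_section_eq U d s s' : (forall x, U x -> s x = s' x) ->
  twist_section U d s -> twist_section U d s'.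
Proof.
move=> ss' sec_s x Ux; have [e [f [p [q [hp hq ef qx spq]]]]] := sec_s x Ux.
by exists e, f, p, q; split=> // y Uy /spq <-; rewrite ?ss'.
Qed.

Lemma twist_sectionM U d1 d2 s1 s2 : twist_section U d1 s1 ->
  twist_section U d2 s2 -> twist_section U (d1 + d2) (fun y => s1 y * s2 y).
Proof.
move=> sec1 sec2 x Ux.
have [e1 [f1 [p1 [q1 [hp1 hq1 ef1 q1x spq1]]]]] := sec1 x Ux.
have [e2 [f2 [p2 [q2 [hp2 hq2 ef2 q2x spq2]]]]] := sec2 x Ux.
exists (e1 + e2)%N, (f1 + f2)%N, (p1 * p2), (q1 * q2); split.
- exact: dhomogM.
- exact: dhomogM.
- by rewrite !PoszD ef1 ef2 addrACA.
- by rewrite mevalM mulf_neq0.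
move=> y Uy; rewrite !mevalM mulf_eq0 negb_or => /andP[q1y q2y].
by rewrite spq1 // spq2 // mulf_div.
Qed.

Lemma twist_section_const U c : twist_section U 0 (fun=> c).
Proof.
move=> x _; exists 0%N, 0%N, c%:MP, 1; split=> //.
- by rewrite -alg_mpolyC; apply/dhomogZ/dhomog1.
- exact: dhomog1.
- by rewrite meval1 oner_neq0.
by move=> y _ _; rewrite mevalC meval1 divr1.
Qed.

(** On the affine chart where x_a does not vanish, x_a^d trivializes O(d). *)
Lemma twist_section_coord (a : 'I_n.+1) d :
  twist_section (@coord_open k n a) d (fun y => y 0 a ^ d).
Proof.
have homX m : ('X_a ^+ m : {mpoly k[n.+1]}) \is m.-homog.
  by rewrite mpolyXn dhomogX /= mdegMn mdeg1 mul1n.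
case: d => m x xa.
  exists m, 0%N, ('X_a ^+ m), 1; split=> //; first exact: dhomog1.
    by rewrite meval1 oner_neq0.
  by move=> y _ _; rewrite rmorphXn /= mevalXU meval1 divr1.
exists 0%N, m.+1, 1, ('X_a ^+ m.+1); split=> //; first exact: dhomog1.
- by rewrite NegzE subrr.
- by rewrite rmorphXn /= mevalXU expf_neq0.
by move=> y _ _; rewrite rmorphXn /= mevalXU meval1 div1r.
Qed.

Lemma frame_scale (a : 'I_n.+1) (m r : nat) (b : m.-tuple int) (e : 'I_r -> int)
    (F : 'rV[k]_n.+1 -> 'M[k]_(r, m)) :
    (forall i j,
       twist_section (@coord_open k n a) (tnth b j - e i) (fun y => F y i j)) ->
  bundle_hom (@coord_open k n a) (nseq_tuple r 0) b
    (fun y => \matrix_(i, j) (y 0 a ^ e i * F y i j)).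
Proof.
move=> secF i j; rewrite tnth_nseq subr0.
rewrite -[tnth b j](subrK (e i)) addrC.
apply: twist_section_eq (twist_sectionM (@twist_section_coord a (e i)) (secF i j)).
by move=> y _; rewrite mxE.
Qed.

(** A fibrewise injective map from a sum of line bundles O(e_i) spans a
    subbundle: on each affine chart, multiplying its rows by the
    trivializations x_a^(e_i) turns it into a frame, i.e. a map from O^r. *)
Lemma subbundle_frame (m r : nat) (b : m.-tuple int) (e : 'I_r -> int)
    (F : 'rV[k]_n.+1 -> 'M[k]_(r, m)) :
    (forall a i j,
       twist_section (@coord_open k n a) (tnth b j - e i) (fun y => F y i j)) ->
    (forall y, y != 0 -> row_free (F y)) ->
  subbundle b r (fun y => <<F y>>%MS).
Proof.
move=> secF freeF x nzx; have /rV0Pn[a xa] := nzx.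
exists (coord_open a).
exists (fun y : 'rV[k]_n.+1 => \matrix_(i, j) (y 0 a ^ e i * F y i j)).
split=> //; first exact: coord_open_zariski.
  exact: frame_scale.
move=> y ya; have nzy := coord_open_neq0 ya.
pose D := diag_mx (\row_i (y 0 a ^ e i)).
have -> : \matrix_(i, j) (y 0 a ^ e i * F y i j) = D *m F y.
  by rewrite mul_diag_mx; apply/matrixP => i j; rewrite !mxE.
have unitD : D \in unitmx.
  rewrite unitmxE det_diag unitfE; apply/prodf_neq0 => i _.
  by rewrite mxE expfz_neq0.
rewrite /row_free mxrankMfree ?freeF // mxrank_unit // eqxx; split=> //.
rewrite !genmxE submxMl /=.
by rewrite -{1}(mulKmx unitD (F y)) submxMl.
Qed.

End TwistSections.

(** Suppose that alpha_ij vanishes nowhere.  Then the i-th summand L of the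
    middle term maps isomorphically onto the span D of the i-th row of alpha,
    and D is a direct summand: the summands of the target other than the j-th
    one span a complement W', since the j-th coordinate of D never vanishes. *)
Lemma minimal_entry_vanishes (k : closedFieldType) (n l m p : nat)
    (c : l.-tuple int) (b : m.-tuple int) (a : p.+1.-tuple int)
    (beta : 'rV[k]_n.+1 -> 'M[k]_(l, m))
    (alpha : 'rV[k]_n.+1 -> 'M[k]_(m, p.+1)) (i : 'I_m) (j : 'I_p.+1) :
    bundle_hom (@projective_space k n) b a alpha ->
    is_minimal c b a beta alpha ->
  exists2 x, x != 0 & alpha x i j = 0.
Proof.
move=> sec_alpha [min_alpha _]; apply: NNPP => nz_ij; apply: min_alpha.
have {}nz_ij x : x != 0 -> alpha x i j != 0.
  by move=> nzx; apply: contra_notN nz_ij => /eqP; exists x.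
have nz_row x : x != 0 -> row i (alpha x) != 0.
  move=> nzx; apply: contraNneq (nz_ij _ nzx) => /rowP/(_ j).
  by rewrite !mxE => ->.
have secU a0 i' j' : twist_section (@coord_open k n a0) (tnth a j' - tnth b i')
    (fun y => alpha y i' j').
  exact: twist_section_sub (@coord_open_neq0 k n a0) (sec_alpha i' j').
have sec_const a0 d t : (t != 0 -> d = 0) ->
    twist_section (@coord_open k n a0) d (fun=> t).
  have [->|_ /(_ isT)->] := eqVneq t 0; last exact: twist_section_const.
  rewrite -[d]addr0 => _.
  apply: twist_section_eq (twist_sectionM (@twist_section_coord k n a0 d)
    (@twist_section_const k n _ 0)) => y _.
  by rewrite mulr0.
pose W' : 'M[k]_(p, p.+1) := rowsub (lift j) 1%:M.
have freeW' : row_free W'.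
  apply/row_freeP; exists (colsub (lift j) 1%:M); rewrite mul_rowsub_mx mul1mx.
  apply/matrixP => u v; rewrite !mxE (inj_eq (@lift_inj _ j)) //.
exists 1%N, (fun x => <<row i (alpha x)>>%MS).
exists (fun=> <<delta_mx 0 i : 'rV[k]_m>>%MS).
split=> //.
- split.
    apply: (subbundle_frame (e := fun=> tnth b i)) => [a0 u v|y nzy].
      by apply: twist_section_eq (secU a0 i v) => y _; rewrite mxE.
    by rewrite /row_free rank_rV nz_row.
  exists p, (fun=> <<W'>>%MS); split.
    apply: (subbundle_frame (e := fun u => tnth a (lift j u))) => [a0 u v|//].
    apply: sec_const; rewrite !mxE; case: (lift j u =P v) => [->|].
      by rewrite subrr.
    by rewrite eqxx.
  move=> x nzx; have cap0 : (<<row i (alpha x)>> :&: <<W'>> = 0)%MS.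
    apply/eqP; rewrite -submx0; apply/rV_subP => v; rewrite sub_capmx !genmxE.
    case/andP=> /sub_rVP[t ->] /submxP[w /rowP/(_ j)]; rewrite !mxE big1 => [|u _].
      move/eqP; rewrite mulf_eq0 (negPf (nz_ij _ nzx)) orbF => /eqP->.
      by rewrite scale0r sub0mx.
    by rewrite !mxE eq_sym (negPf (neq_lift j u)) mulr0.
  split=> //; rewrite submx1 sub1mx /row_full /=.
  rewrite mxrank_disjoint_sum // !mxrank_gen (eqP freeW') rank_rV.
  by rewrite nz_row.
- apply: (subbundle_frame (e := fun=> tnth b i)) => [a0 u v|y nzy].
    apply: sec_const; rewrite mxE ord1 eqxx /=; case: (v =P i) => [->|].
      by rewrite subrr.
    by rewrite eqxx.
  rewrite /row_free rank_rV eqb1; apply/eqP => /rowP/(_ i)/eqP.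
  by rewrite !mxE !eqxx oner_eq0.
move=> x nzx; rewrite !genmxE rowE.
by rewrite !(eqmxMr (alpha x) (genmxE (delta_mx 0 i))) !submx_refl.
Qed.

(** * The monad *)

Theorem proposition15 (k : closedFieldType) (k_char0 : [pchar k] =i pred0) :
  ~ exists (beta : 'rV[k]_4 -> 'M[k]_(2, 3 + 3))
           (alpha : 'rV[k]_4 -> 'M[k]_(3 + 3, 2)),
      is_monad (in_tuple [:: -2; -4])
        (cat_tuple (nseq_tuple 3 1) (nseq_tuple 3 (-2)))
        (in_tuple [:: 1; 3]) beta alpha /\
      is_minimal (in_tuple [:: -2; -4])
        (cat_tuple (nseq_tuple 3 1) (nseq_tuple 3 (-2)))
        (in_tuple [:: 1; 3]) beta alpha.
Proof.
move=> [beta [alpha [[_ sec_alpha _ _ full_alpha] min_alpha]]].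
have top0 (i : 'I_3) x : x != 0 -> alpha x (lshift 3 i) 0 = 0.
  have [y nzy <-] := minimal_entry_vanishes (lshift 3 i) 0 sec_alpha min_alpha.
  move=> nzx; have := sec_alpha (lshift 3 i) 0; rewrite tnth_lshift tnth_nseq.
  by move/(global_section0_constant (s := fun x => alpha x _ _)); apply.
have cubic (i : 'I_3) : exists p : {mpoly k[4]}, p \is 3.-homog /\
    forall x, x != 0 -> alpha x (rshift 3 i) 0 = p.@[x 0].
  have := sec_alpha (rshift 3 i) 0; rewrite tnth_rshift tnth_nseq.
  move/(global_section_form (d := 3) k_char0 isT) => [p hp pE].
  by exists p; split.
have /fin_all_exists[p /all_and2[hp pE]] := cubic.
have [x [i xi] px0] :=
  forms_common_zero (d := fun=> 3) (ltnSn 3) (fun=> isT) hp.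
pose v : 'rV[k]_4 := \row_j x j.
have nzv : v != 0 by apply/rV0Pn; exists i; rewrite mxE.
have col0 : col 0 (alpha v) = 0.
  apply/colP => j; rewrite !mxE; case: (splitP j) => j' def_j.
    have -> : j = lshift 3 j' by apply: val_inj.
    exact: top0.
  have -> : j = rshift 3 j' by apply: val_inj.
  rewrite pE // -[RHS](px0 j'); apply: meval_eq => l; by rewrite mxE.
have /row_fullP[B BA] := full_alpha v nzv.
have /matrixP/(_ 0 0) : col 0 (B *m alpha v) = 0.
  by rewrite colE -mulmxA -colE col0 mulmx0.
by rewrite BA !mxE => /eqP; rewrite oner_eq0.
Qed.
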